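(* The metric ratio function $\Upsilon_m$ is unbounded; in other words, for any $c\ge 2$, there exist non-Archimedean metric spaces $X$ and $Y$ with $d_{GH}(X,Y)>0$ such that $\widehat{d}_{GH}(X,Y)\ge c\cdot d_{GH}(X,Y)$.
   Context: A non-Archimedean metric space $(X,\widehat{d}_X)$ is a set with a metric satisfying the strong triangle inequality $\widehat{d}_X(x,z)\le\max\{\widehat{d}_X(x,y),\widehat{d}_X(y,z)\}$ for all $x,y,z\in X$. For subsets $A,B$ of a metric space $(Z,d)$, the Hausdorff distance is $d_H(A,B)=\max\{\sup_{a\in A}\mathrm{dist}(a,B),\ \sup_{b\in B}\mathrm{dist}(b,A)\}$, where $\mathrm{dist}(z,A)=\inf\{d(z,a):a\in A\}$; it is written $\widehat{d}_H$ when the metric on $Z$ is a non-Archimedean metric $\widehat{d}_Z$. The non-Archimedean Gromov-Hausdorff distance of two non-Archimedean metric spaces is $\widehat{d}_{GH}(X,Y)=\inf\{\widehat{d}_{H}(f(X),g(Y))\}$, the infimum being over all non-Archimedean metric spaces $(Z,\widehat{d}_Z)$ and all isometric embeddings $f:X\hookrightarrow Z$, $g:Y\hookrightarrow Z$. The usual Gromov-Hausdorff distance $d_{GH}(X,Y)$ is defined in the same way, with the infimum over all metric spaces $(Z,d_Z)$ and all isometric embeddings of $X$ and $Y$ into $Z$. For non-Archimedean metric spaces $X,Y$ with $d_{GH}(X,Y)>0$, the metric ratio function is $\Upsilon_m(X,Y)=\widehat{d}_{GH}(X,Y)/d_{GH}(X,Y)$. *)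

(* Defs.v *)
(* MathComp-Analysis; the real numbers are an arbitrary [R : realType]. *)
From mathcomp Require Import all_boot all_order all_algebra.
From mathcomp Require Import all_classical all_reals all_analysis.

Set Implicit Arguments.
Unset Strict Implicit.
Unset Printing Implicit Defensive.

Import Order.TTheory GRing.Theory Num.Theory.

Local Open Scope classical_set_scope.
Local Open Scope ring_scope.

Definition non_archimedean (R : realType) (X : metricType R) : Prop :=
  forall x y z : X, mdist x z <= Num.max (mdist x y) (mdist y z).

Definition isometric_embedding (R : realType) (X Z : metricType R)
    (f : X -> Z) : Prop :=
  forall x y : X, mdist (f x) (f y) = mdist x y.

Local Open Scope ereal_scope.

(* All distances below are extended real: [set_dist z set0 = +oo], the
   Hausdorff distance of unbounded sets may be [+oo], and the Hausdorff
   distance of the empty set to itself is the junk value [-oo]. *)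
Definition set_dist (R : realType) (Z : metricType R) (z : Z) (A : set Z)
    : \bar R :=
  ereal_inf [set (mdist z a)%:E | a in A].

Definition hausdorff_dist (R : realType) (Z : metricType R) (A B : set Z)
    : \bar R :=
  Order.max (ereal_sup [set set_dist a B | a in A])
            (ereal_sup [set set_dist b A | b in B]).

Definition GH_dist (R : realType) (X Y : metricType R) : \bar R :=
  ereal_inf [set r | exists (Z : metricType R) (f : X -> Z) (g : Y -> Z),
    [/\ isometric_embedding f, isometric_embedding g
      & r = hausdorff_dist (range f) (range g)]].

Definition na_GH_dist (R : realType) (X Y : metricType R) : \bar R :=
  ereal_inf [set r | exists (Z : metricType R) (f : X -> Z) (g : Y -> Z),
    [/\ non_archimedean Z, isometric_embedding f, isometric_embedding g
      & r = hausdorff_dist (range f) (range g)]].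

(* The pairs on which the ratio of the two distances is a quotient of real
   numbers with positive denominator.  Without the finiteness conditions,
   pairs at infinite distance would satisfy [c * GH_dist <= na_GH_dist] for
   trivial reasons.  They also exclude empty spaces. *)
Definition ratio_domain (R : realType) (X Y : metricType R) : Prop :=
  [/\ non_archimedean X, non_archimedean Y,
      0 < GH_dist X Y, GH_dist X Y < +oo & na_GH_dist X Y < +oo].

(* Only meaningful on [ratio_domain]. *)
Definition metric_ratio (R : realType) (X Y : metricType R) : R :=
  (fine (na_GH_dist X Y) / fine (GH_dist X Y))%R.

(* Main.v *)
(** Two-point spaces of diameters [1] and [l > 1] already suffice.  Inside the
    line they lie within [l - 1] of each other, and [(l - 1) / 2] is a lower
    bound in any ambient space.  In an ultrametric space, however, a triangle
    has its two longest sides equal, so moving both points by less than [l]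
    cannot turn the distance [1] into [l]: the non-Archimedean distance is at
    least [l], and the ratio is at least [l / (l - 1)]. *)
From HB Require Import structures.
Require Import Defs.
From mathcomp Require Import all_boot all_order all_algebra.
From mathcomp Require Import all_classical all_reals all_analysis.
From mathcomp Require Import lra.

Import Order.TTheory GRing.Theory Num.Theory.

Local Open Scope classical_set_scope.
Local Open Scope ring_scope.

(** The alias records [w], so that each weight carries its own metric instance on the same carrier.
    Taking the larger weight as distance gives an ultrametric for every positive [w], which covers
    the two-point spaces and their three-point gluing at once. *)
Definition weighted (R : realType) (T : choiceType) (w : T -> {posnum R}) : Type :=
  T.

Section WeightedSpace.
Context (R : realType) (T : choiceType) (w : T -> {posnum R}).
Implicit Types x y z : T.

Definition weighted_dist x y : R :=
  if x == y then 0 else Num.max (w x)%:num (w y)%:num.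

Let dist_ge0 x y : 0 <= weighted_dist x y.
Proof. by rewrite /weighted_dist; case: eqP => // _; rewrite le_max ge0. Qed.

Let dist_xx x : weighted_dist x x = 0.
Proof. by rewrite /weighted_dist eqxx. Qed.

Let dist_eq0 x y : weighted_dist x y = 0 -> x = y.
Proof.
rewrite /weighted_dist; case: eqP => // _ h.
by have : 0 < (w x)%:num by []; rewrite ltNge -h le_max lexx.
Qed.

Let dist_sym x y : weighted_dist x y = weighted_dist y x.
Proof. by rewrite /weighted_dist eq_sym maxC. Qed.

(** If [y] differs from [x] and [z], both weights [w x] and [w z] occur on the right; if it equals
    one of them, the left side itself occurs there. *)
Lemma weighted_dist_ultra x y z :
  weighted_dist x z <= Num.max (weighted_dist x y) (weighted_dist y z).
Proof.
rewrite {1}/weighted_dist; case: eqP => [_|/eqP xz]; first by rewrite le_max dist_ge0.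
rewrite /weighted_dist; have [<-|xy] := eqVneq x y.
  by rewrite (negPf xz) le_max lexx orbT.
have [<-|yz] := eqVneq y z; first by rewrite le_max lexx.
by rewrite ge_max !le_max !lexx ?orbT.
Qed.

Let dist_triangle y x z :
  weighted_dist x z <= weighted_dist x y + weighted_dist y z.
Proof.
by rewrite (le_trans (weighted_dist_ultra x y z))// ge_max lerDl lerDr !dist_ge0.
Qed.

HB.instance Definition _ := Choice.on (weighted R T w).
HB.instance Definition _ := isMetric.Build R (weighted R T w)
  dist_xx dist_eq0 dist_sym dist_triangle.

End WeightedSpace.

Lemma weighted_mdist (R : realType) (T : choiceType) (w : T -> {posnum R})
    (x y : weighted R T w) : mdist x y = weighted_dist R T w x y.
Proof. by []. Qed.

Lemma weighted_non_archimedean (R : realType) (T : choiceType) (w : T -> {posnum R}) :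
  non_archimedean (weighted R T w : metricType R).
Proof. exact: weighted_dist_ultra. Qed.

(** A strict upper bound on an infimum is attained by an actual point. The lower bounds below use
    this to find partners in the smaller space for both points of the larger one. *)
Lemma hausdorff_dist_lt (R : realType) (X Y : Type) (Z : metricType R)
    (f : X -> Z) (g : Y -> Z) (d : R) :
  (hausdorff_dist (range f) (range g) < d%:E)%E ->
  forall y, exists x, mdist (g y) (f x) < d.
Proof.
rewrite /hausdorff_dist gt_max => /andP[_ fgd] y.
have : (set_dist (g y) (range f) < d%:E)%E.
  by apply: le_lt_trans fgd; apply: ereal_sup_ubound; exists (g y) => //; exists y.
by move=> /ereal_inf_lt[_ [_ [x _ <-] <-]]; rewrite lte_fin => ?; exists x.
Qed.

Lemma hausdorff_dist_le (R : realType) (X Y : Type) (Z : metricType R)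
    (f : X -> Z) (g : Y -> Z) (d : R) :
  (forall x, exists y, mdist (f x) (g y) <= d) ->
  (forall y, exists x, mdist (g y) (f x) <= d) ->
  (hausdorff_dist (range f) (range g) <= d%:E)%E.
Proof.
have half (U V : Type) (h : U -> Z) (k : V -> Z) :
    (forall u, exists v, mdist (h u) (k v) <= d) ->
    (ereal_sup [set set_dist a (range k) | a in range h] <= d%:E)%E.
  move=> hk; apply: ge_ereal_sup => _ [_ [u _ <-] <-].
  have [v huv] := hk u.
  apply: (@le_trans _ _ (mdist (h u) (k v))%:E); last by rewrite lee_fin.
  by apply: ereal_inf_lbound; exists (k v) => //; exists v.
by move=> fg gf; rewrite /hausdorff_dist ge_max !half.
Qed.

Definition two_point (R : realType) (l : {posnum R}) : metricType R :=
  weighted R bool (fun=> l).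

Lemma two_pointE (R : realType) (l : {posnum R}) (x y : two_point R l) :
  mdist x y = if x == y then 0 else l%:num.
Proof. by rewrite weighted_mdist /weighted_dist maxxx. Qed.

Section TwoPointSpaces.
Context (R : realType) (a b : {posnum R}).
Hypothesis ab : a%:num < b%:num.
Let X := two_point R a.
Let Y := two_point R b.

Let mdist_le_a (x x' : X) : mdist x x' <= a%:num.
Proof. by rewrite two_pointE; case: eqP. Qed.

(** The partners of the two points of [Y], whether or not they coincide, are at most [a] apart. With
    both moves shorter than [(b - a) / 2], the triangle inequality would give [b < a + (b - a)]. *)
Lemma GH_dist_two_point_ge : (((b%:num - a%:num) / 2)%:E <= GH_dist X Y)%E.
Proof.
apply: le_ereal_inf_tmp => _ [Z [f [g [iso_f iso_g ->]]]].
rewrite leNgt; apply/negP => /hausdorff_dist_lt near_g.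
have [x0 gf0] := near_g false; have [x1 gf1] := near_g true.
have := metric_triangle (g false) (f x0) (g true).
have := metric_triangle (f x0) (f x1) (g true).
have := mdist_le_a x0 x1.
rewrite iso_f iso_g (metric_sym (f x1)) [mdist (_ : Y) _]two_pointE /=.
lra.
Qed.

Lemma na_GH_dist_two_point_ge : (b%:num%:E <= na_GH_dist X Y)%E.
Proof.
apply: le_ereal_inf_tmp => _ [Z [f [g [ultra_Z iso_f iso_g ->]]]].
rewrite leNgt; apply/negP => /hausdorff_dist_lt near_g.
have [x0 gf0] := near_g false; have [x1 gf1] := near_g true.
(* Along the chain [g false], [f x0], [f x1], [g true] every step is shorter than [b], the middle
   one because [a < b]. *)
suff : mdist (g false) (g true) < b%:num.
  by rewrite iso_g [mdist (_ : Y) _]two_pointE ltxx.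
apply: le_lt_trans (ultra_Z _ (f x0) _) _; rewrite gt_max gf0 /=.
apply: le_lt_trans (ultra_Z _ (f x1) _) _; rewrite gt_max iso_f.
by rewrite (le_lt_trans (mdist_le_a x0 x1) ab) metric_sym.
Qed.

Lemma GH_dist_two_point_le : (GH_dist X Y <= (b%:num - a%:num)%:E)%E.
Proof.
(* Both spaces are put on the real line with [false] at the origin, so points with the same label
   are [0] or [b - a] apart. *)
have embed (l : {posnum R}) :
    isometric_embedding
      ((fun x => if x then l%:num else 0) : two_point R l -> (R^o : metricType R)).
  by case=> -[]; rewrite two_pointE /mdist /= ?(subrr, subr0, sub0r, normrN) ?normr0 ?gtr0_norm.
apply: (@le_trans _ _ (hausdorff_dist
    (range ((fun x => if x then a%:num else 0) : X -> (R^o : metricType R)))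
    (range ((fun x => if x then b%:num else 0) : Y -> (R^o : metricType R))))).
  by apply: ereal_inf_lbound; do 3 eexists; split; [exact: embed|exact: embed|].
have ba0 : 0 <= b%:num - a%:num by rewrite subr_ge0 ltW.
apply: hausdorff_dist_le => x; exists x; rewrite /mdist /=; case: x.
- by rewrite ger0_norm.
- by rewrite subrr normr0.
- by rewrite distrC ger0_norm.
- by rewrite subrr normr0.
Qed.

Lemma na_GH_dist_two_point_le : (na_GH_dist X Y <= b%:num%:E)%E.
Proof.
(* The two spaces glued along one point, [None]. *)
pose w (o : option bool) := if o == Some true then b else a.
pose Z : metricType R := weighted R (option bool) w.
pose f : X -> Z := fun x => if x then Some false else None.
pose g : Y -> Z := fun y => if y then Some true else None.
apply: (@le_trans _ _ (hausdorff_dist (range f) (range g))).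
  apply: ereal_inf_lbound; exists Z, f, g; split=> //.
  - exact: weighted_non_archimedean.
  - by case=> -[]; rewrite two_pointE weighted_mdist /weighted_dist /= ?maxxx.
  - case=> -[]; rewrite two_pointE weighted_mdist /weighted_dist /= ?maxxx //.
      by rewrite max_l// ltW.
    by rewrite max_r// ltW.
(* Since [Z] has diameter at most [b], any choice of partners will do. *)
have dist_le (z z' : Z) : mdist z z' <= b%:num.
  have w_le o : (w o)%:num <= b%:num by rewrite /w; case: ifP => // _; exact: ltW.
  by rewrite weighted_mdist /weighted_dist; case: eqP => // _; rewrite ge_max !w_le.
by apply: hausdorff_dist_le => x; [exists false|exists false]; exact: dist_le.
Qed.

Lemma ratio_domain_two_point : ratio_domain X Y.
Proof.
split; try exact: weighted_non_archimedean.
- apply: lt_le_trans GH_dist_two_point_ge.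
  by rewrite lte_fin divr_gt0// subr_gt0.
- exact: le_lt_trans GH_dist_two_point_le (ltry _).
- exact: le_lt_trans na_GH_dist_two_point_le (ltry _).
Qed.

End TwoPointSpaces.

Lemma metric_ratio_ge (R : realType) (X Y : metricType R) (c : R) :
  ratio_domain X Y -> 0 <= c -> (c%:E * GH_dist X Y <= na_GH_dist X Y)%E ->
  c <= metric_ratio X Y.
Proof.
(* Only real values survive the case analyses: the domain bounds [GH_dist] on both sides and
   [na_GH_dist] from above, and the assumed inequality rules out [-oo] for the latter. *)
rewrite /metric_ratio => -[_ _]; case: (GH_dist X Y) => //= d d0 _.
case: (na_GH_dist X Y) => //= e _ c0; rewrite -EFinM !lee_fin => cde.
by rewrite ler_pdivlMr.
Qed.

Theorem theoremG (R : realType) :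
  ~ has_ubound [set r : R | exists X Y : metricType R,
      ratio_domain X Y /\ r = metric_ratio X Y]
  /\
  (forall c : R, 2 <= c ->
    exists X Y : metricType R,
      ratio_domain X Y /\ (c%:E * GH_dist X Y <= na_GH_dist X Y)%E).
Proof.
have unbounded (c : R) : 2 <= c -> exists X Y : metricType R,
    ratio_domain X Y /\ (c%:E * GH_dist X Y <= na_GH_dist X Y)%E.
  move=> c2; have c0 : 0 < c by lra.
  (* With [a = 1] and [b = 1 + c^-1], the product [c * (b - a)] is exactly [1], which is at most
     [b]. *)
  pose a : {posnum R} := PosNum (@ltr01 R).
  have b0 : 0 < 1 + c^-1 by rewrite addr_gt0// invr_gt0.
  pose b : {posnum R} := PosNum b0.
  have ab : a%:num < b%:num by rewrite /= ltrDl invr_gt0.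
  exists (two_point R a), (two_point R b); split.
    exact: ratio_domain_two_point.
  apply: le_trans (na_GH_dist_two_point_ge _ _ _ ab).
  apply: (@le_trans _ _ (c%:E * (b%:num - a%:num)%:E)%E).
    by apply: lee_wpmul2l (GH_dist_two_point_le _ _ _ ab); rewrite lee_fin ltW.
  rewrite -EFinM lee_fin /= addrAC subrr add0r divff ?gt_eqF//.
  by rewrite lerDl invr_ge0 ltW.
split=> // -[M ubM].
(* This constant is admissible and forces a ratio of at least [M + 1], beyond the supposed bound
   [M]. *)
have c2 : 2 <= Num.max 2 (M + 1) by rewrite le_max lexx.
have [X [Y [dom cXY]]] := unbounded _ c2.
have := metric_ratio_ge _ _ _ _ dom (le_trans (ler0n _ 2) c2) cXY.
rewrite ge_max => /andP[_]; apply/negP; rewrite -ltNge.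
by apply: (@le_lt_trans _ _ M); [apply: ubM; exists X, Y|rewrite ltrDl].
Qed.
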